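(* Let $\mathcal{H}$ be a nonempty finite class of hypotheses $h:X\to\{-1,+1\}$, let $D$ be a probability distribution on $X\times\{-1,+1\}$ and let $m\ge1$ be an integer. For any $\eta>0$ and any $\delta>0$ (with $\delta\le\sqrt2$, so that the following quantity is defined), set $$\Delta=2\sqrt{\frac{\ln(\sqrt2/\delta)}{m}}+\frac{\eta}{8m}.$$ Then, with probability at least $1-\delta$ over the random choice of the training set $S\sim D^m$, $$\Pr_{(x,y)\sim D}\left[\hat p_{\eta,\Delta}(x)\ne 0\ \text{ and }\ \hat p_{\eta,\Delta}(x)\ne\mathrm{sign}(\ell_\eta(x))\right]\le\delta .$$
   Context: $X$ is a measurable space and all hypotheses are measurable. $S=((x_1,y_1),\dots,(x_m,y_m))$ is a sample of $m$ examples drawn independently from $D$. For $h\in\mathcal{H}$, the true error is $\varepsilon(h)=\Pr_{(x,y)\sim D}[h(x)\ne y]$ and the empirical error is $\hat\varepsilon(h)=\frac1m\sum_{i=1}^m \mathbf{1}[h(x_i)\ne y_i]$. For $\eta>0$ and $x\in X$, the true and empirical log ratios are $$\ell_\eta(x)=\frac1\eta\ln\frac{\sum_{h\in\mathcal{H}:h(x)=+1}e^{-\eta\varepsilon(h)}}{\sum_{h\in\mathcal{H}:h(x)=-1}e^{-\eta\varepsilon(h)}},\qquad \hat\ell_\eta(x)=\frac1\eta\ln\frac{\sum_{h\in\mathcal{H}:h(x)=+1}e^{-\eta\hat\varepsilon(h)}}{\sum_{h\in\mathcal{H}:h(x)=-1}e^{-\eta\hat\varepsilon(h)}}.$$ Convention: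 if all hypotheses agree on $x$, both log ratios equal $+\infty$ (if all predict $+1$) or both equal $-\infty$ (if all predict $-1$). For $\Delta\ge0$, the algorithm's prediction is $\hat p_{\eta,\Delta}(x)=\mathrm{sign}(\hat\ell_\eta(x))$ if $|\hat\ell_\eta(x)|>\Delta$, and $\hat p_{\eta,\Delta}(x)=0$ otherwise. Here $\mathrm{sign}(z)=+1$ for $z>0$, $-1$ for $z<0$, and $\mathrm{sign}(0)$ is any fixed value in $\{-1,0,+1\}$. *)

(* Defs.v *)
From HB Require Import structures.
From mathcomp Require Import all_boot all_order all_algebra.
From mathcomp Require Import finmap.
From mathcomp Require Import all_classical all_reals all_analysis.

Set Implicit Arguments.
Unset Strict Implicit.
Unset Printing Implicit Defensive.

Import Order.TTheory GRing.Theory Num.Theory.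
Local Open Scope classical_set_scope.
Local Open Scope ring_scope.

Section product_probability.
Context (R : realType) (d : measure_display) (T : measurableType d).
Variable D : probability T R.

Definition tcons n (z : T * n.-tuple T) : n.+1.-tuple T := [tuple of z.1 :: z.2].

Lemma measurable_tcons n : measurable_fun [set: T * n.-tuple T] (@tcons n).
Proof. exact: measurable_cons measurable_fst measurable_snd. Qed.

HB.instance Definition _ n :=
  isMeasurableFun.Build _ _ _ _ (@tcons n) (@measurable_tcons n).

(* D^n on n-tuples with the product sigma-algebra: D^0 is the point mass on the
   empty tuple, and D^(n+1) is the image of D \x D^n under consing. The defining
   product rule on measurable rectangles is prod_probabilityE. *)
Fixpoint prod_probability n : probability (n.-tuple T) R :=
  match n with
  | 0 => \d_[tuple]
  | k.+1 => distribution (D \x prod_probability k)%E (@tcons k)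
  end.

Lemma prod_probabilityE n (A : 'I_n -> set T) : (forall i, measurable (A i)) ->
  prod_probability n [set s | forall i, A i (tnth s i)] =
  (\prod_(i < n) D (A i))%E.
Proof.
elim: n A => [|n IH] A mA.
  by rewrite big_ord0/= diracE mem_set//=; case.
rewrite big_ord_recl -(IH (fun i => A (lift ord0 i)))//=.
rewrite /distribution /pushforward/= -product_measure1E//=.
  congr product_measure1; apply/seteqP; split => -[x s] /=.
    move=> h; split => [|i]; first exact: (h ord0).
    by move: (h (lift ord0 i)); rewrite tnthS.
  by case=> h0 h i; case: (unliftP ord0 i) => [j ->|->]//; rewrite tnthS.
rewrite (_ : mkset _ =
  \bigcap_(i in [set: 'I_n]) ((@tnth n T)^~ i @^-1` A (lift ord0 i))).
  apply: fin_bigcap_measurable => [|i _]; first exact: finite_finset.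
  by rewrite -[X in measurable X]setTI; exact: measurable_tnth.
by apply/seteqP; split => s/= h i; [move=> _|]; exact: h.
Qed.

End product_probability.

(* The labels -1 and +1 are represented by the booleans false and true, so that
   bool carries the discrete sigma-algebra of the two-point label space; the
   predictions, which may also be 0, are integers. A hypothesis is a function
   X -> bool and a hypothesis class is a finite set of such functions. *)
Section averaging_classifier.
Context (R : realType) (d : measure_display) (X : measurableType d).
Implicit Types (h : X -> bool) (H : {fset (X -> bool)}) (x : X).

Definition true_error (D : probability (X * bool)%type R) h : R :=
  fine (D [set z | h z.1 != z.2]).

Definition empirical_error m (S : m.-tuple (X * bool)) h : R :=
  m%:R^-1 * \sum_(i < m) (h (tnth S i).1 != (tnth S i).2)%:R.

(* The two log ratios are the instances err := true_error D and
   err := empirical_error S. *)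
Definition log_ratio H (eta : R) (err : (X -> bool) -> R) x : \bar R :=
  if all (fun h => h x) H then +oo%E
  else if all (fun h => ~~ h x) H then -oo%E
  else (eta^-1 * ln ((\sum_(h <- H | h x) expR (- eta * err h)) /
                     (\sum_(h <- H | ~~ h x) expR (- eta * err h))))%:E.

(* s0 is the value chosen for sign(0). *)
Definition esign (s0 : int) (z : \bar R) : int :=
  if (0 < z)%E then 1 else if (z < 0)%E then -1 else s0.

Definition prediction s0 H (eta Delta : R) m (S : m.-tuple (X * bool)) x : int :=
  let l := log_ratio H eta (empirical_error S) x in
  if (Delta%:E < `|l|)%E then esign s0 l else 0.

End averaging_classifier.

(* Main.v *)
Require Import Defs.
From mathcomp Require Import all_boot all_order all_algebra.
From mathcomp Require Import finmap.
From mathcomp Require Import all_classical all_reals all_analysis.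
From mathcomp Require Import ring lra.
Import Order.TTheory GRing.Theory Num.Theory.
Import numFieldNormedType.Exports.
Local Open Scope classical_set_scope.
Local Open Scope ring_scope.
Set Implicit Arguments.
Unset Strict Implicit.
Unset Printing Implicit Defensive.

(** Fix a point [x].  The prediction at [x] is wrong only if the empirical log
ratio exceeds [Delta] in absolute value while the true log ratio has the other
sign or vanishes, so only if the two differ by more than [Delta].  The main
point is that this has probability at most [delta ^+ 2] over the sample,
uniformly in [x].  Then the expectation over the sample of the mass of wrongly
predicted points is also at most [delta ^+ 2] by exchanging the two averages,
and Markov's inequality at level [delta] gives the theorem
([mostly_small_sections]).

The deviation splits into a fluctuation and a bias.

Fluctuation.  Replacing one of the [m] examples changes every empirical error by
at most [1 / m], hence each log-sum-exp, divided by [eta], by at most [1 / m],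
and the log ratio by at most [2 / m].  McDiarmid's inequality ([mcdiarmid_abs])
applied once to the log ratio itself bounds the probability of a fluctuation
larger than [2 * lam] by [2 * expR (- 2 * m * lam ^ 2)], which is [delta ^+ 2]
for the [lam] in [Delta].  Treating numerator and denominator separately, each
with deviation [lam], would cost another factor 2; that loss would matter when
the true log ratio is zero, where both signs of the empirical one can be wrong.

Bias.  By convexity of log-sum-exp the expectation of the empirical log-sum-exp
is at least the true one ([lse_mean_le]).  By concavity of the logarithm it
exceeds the true one by at most [eta ^+ 2 / (8 * m)], which follows from the
moment generating function bound for a single empirical error
([mean_lse_le]).  So the expected empirical log ratio is within
[eta / (8 * m)] of the true one ([log_ratio_bias]).

Everything above takes place on a finite probability space: both log ratios at
[x], and the mistakes made on an example, depend on the example only through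
its label and the vector of the values at [x] of the finitely many hypotheses.
So expectations are finite sums against the law of this labelled pattern, and
the measures of the theorem are transferred to such sums once and for all by
[law_probability] and [law_sample_probability]. *)

(** * The two-point moment generating function *)

Lemma ge0_is_derive_ge (R : realType) (f f' : R -> R) :
  (forall x : R, is_derive x 1 f (f' x)) -> (forall x, 0 <= x -> 0 <= f' x) ->
  forall x, 0 <= x -> f 0 <= f x.
Proof.
move=> df f'_ge0 x x_ge0; apply: (@ger0_derive1_ndecry _ _ 0) => //.
- move=> y; rewrite in_itv/= andbT => /ltW y_ge0.
  by case: (df y) => _ d_f; rewrite derive1E d_f f'_ge0.
- apply: continuous_subspaceT => y; case: (df y) => f_y _.
  by apply/differentiable_continuous; apply/derivable1_diffP; exact: f_y.
Qed.

(** The centred Bernoulli case, which is extremal in Hoeffding's lemma.  In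
logarithmic form the difference [g] of the two sides vanishes at 0 together with
its derivative [g1], and the derivative of [g1] is [1 / 4 - q * (1 - q)] for the
tilted probability [q], hence nonnegative. *)
Lemma two_point_mgf (R : realType) (th u : R) : 0 <= th <= 1 -> 0 <= u ->
  (1 - th) * expR (- (th * u)) + th * expR ((1 - th) * u) <= expR (u ^+ 2 / 8).
Proof.
move=> /andP[th_ge0 th_le1] u_ge0.
pose Z (v : R) : R := 1 - th + th * expR v.
have Z_gt0 v : 0 < Z v.
  have := expR_gt0 v; rewrite /Z; move: th_ge0; rewrite le_eqVlt => /orP[/eqP<-|].
    by rewrite subr0 mul0r addr0.
  move=> th_gt0 e_gt0; apply: ltr_wpDl; first by rewrite subr_ge0.
  exact: mulr_gt0.
have dZ (v : R) : is_derive v (1:R) Z (th * expR v).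
  by apply: is_derive_eq; rewrite add0r mul1r.
have Zneq0 v : Z v != 0 by rewrite gt_eqF.
pose q (v : R) := th * expR v / Z v.
have qE v : q v = 1 - (1 - th) / Z v.
  have -> : q v = (Z v - (1 - th)) / Z v by rewrite /q /Z; congr (_ / _); ring.
  by rewrite mulrBl divff.
pose g1 (v : R) := v / 4 + th - q v.
pose g (v : R) := v ^+ 2 / 8 + th * v - ln (Z v).
have dg1 (v : R) : is_derive v (1:R) g1 (4^-1 - q v * (1 - q v)).
  rewrite (_ : g1 = fun v => v / 4 + th - (1 - (1 - th) * (Z v)^-1)); last first.
    by apply/funext => w; rewrite /g1 qE.
  have dV : is_derive v (1:R) (fun v => (Z v)^-1) (- (Z v) ^- 2 *: (th * expR v)).
    have [Z_v d_Z] := dZ v.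
    by rewrite -d_Z; split; [exact: derivableV | exact: deriveV].
  by apply: is_derive_eq; rewrite {2}qE /q /GRing.scale/=; field.
have dg (v : R) : is_derive v (1:R) g (g1 v).
  have dln : is_derive v (1:R) (@ln R \o Z) ((Z v)^-1 * (th * expR v)).
    by apply: is_derive1_comp; exact: is_derive1_ln.
  by rewrite /g /g1; apply: is_derive_eq; rewrite /q /GRing.scale/=; field.
have g1_ge0 v : 0 <= v -> 0 <= g1 v.
  move=> v_ge0; have <- : g1 0 = 0.
    by rewrite /g1 /q /Z expR0 mulr1 subrK divr1 mul0r add0r subrr.
  apply: (ge0_is_derive_ge dg1) v_ge0 => w _.
  have := sqr_ge0 (q w - 2^-1); lra.
have : g 0 <= g u by apply: (ge0_is_derive_ge dg) u_ge0.
(* Exponentiate [0 <= g u] and divide by [expR (th * u)]. *)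
rewrite {1}/g {1}/Z expR0 mulr1 subrK ln1 expr0n/= mul0r mulr0 addr0 subrr.
rewrite subr_ge0 -ler_expR lnK ?posrE// expRD.
have -> : expR ((1 - th) * u) = expR u * expR (- (th * u)).
  by rewrite -expRD; congr expR; ring.
rewrite -ler_pdivrMr ?expR_gt0// -expRN; apply: le_trans.
by rewrite le_eqVlt; apply/orP; left; apply/eqP; rewrite /Z; ring.
Qed.

(** * Averages over finite probability spaces *)

Section finite_mean.
Context (R : realType).

Definition is_pmf (T : finType) (p : T -> R) :=
  (forall t, 0 <= p t) /\ \sum_t p t = 1.

Definition mean (T : finType) (p f : T -> R) : R := \sum_t p t * f t.

Section mean_theory.
Context (T : finType) (p : T -> R).
Context (p_pmf : is_pmf p).
Implicit Types f g : T -> R.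

Lemma eq_mean f g : f =1 g -> mean p f = mean p g.
Proof. by move=> fg; apply: eq_bigr => t _; rewrite fg. Qed.

Lemma mean_cst (a : R) : mean p (fun=> a) = a.
Proof. by case: p_pmf => _ p1; rewrite /mean -mulr_suml p1 mul1r. Qed.

Lemma meanD f g : mean p (fun t => f t + g t) = mean p f + mean p g.
Proof. by rewrite /mean -big_split; apply: eq_bigr => t _; rewrite mulrDr. Qed.

Lemma meanZl a f : mean p (fun t => a * f t) = a * mean p f.
Proof. by rewrite /mean mulr_sumr; apply: eq_bigr => t _; rewrite mulrCA. Qed.

Lemma meanN f : mean p (fun t => - f t) = - mean p f.
Proof. by rewrite /mean -sumrN; apply: eq_bigr => t _; rewrite mulrN. Qed.

Lemma meanB f g : mean p (fun t => f t - g t) = mean p f - mean p g.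
Proof. by rewrite meanD meanN. Qed.

Lemma mean_sum (I : finType) (P : pred I) (F : I -> T -> R) :
  mean p (fun t => \sum_(i | P i) F i t) = \sum_(i | P i) mean p (F i).
Proof. by rewrite /mean exchange_big/=; apply: eq_bigr => t _; rewrite mulr_sumr. Qed.

Lemma le_mean f g : (forall t, f t <= g t) -> mean p f <= mean p g.
Proof. by case: p_pmf => p0 _ fg; apply: ler_sum => t _; rewrite ler_wpM2l. Qed.

Lemma mean_ge0 f : (forall t, 0 <= f t) -> 0 <= mean p f.
Proof. by move=> f0; rewrite -(mean_cst 0); exact: le_mean. Qed.

Lemma pmf_inhabited : T.
Proof.
have [//|T0] := pickP (@predT T); exfalso; have [_ /eqP] := p_pmf.
by rewrite big_pred0 ?(eq_sym 0) ?oner_eq0// => t; have := T0 t.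
Qed.

(** On the range [a, a + c] of the centred variable the exponential lies below
its chord, whose mean depends only on the mean of the variable, here 0; what
remains is the two-point case. *)
Lemma hoeffding f (c : R) : (forall s t, f s - f t <= c) ->
  mean p (fun t => expR (f t - mean p f)) <= expR (c ^+ 2 / 8).
Proof.
move=> fc; pose Y t := f t - mean p f.
have EY : mean p Y = 0 by rewrite /Y meanB mean_cst subrr.
have Yc s t : Y s - Y t <= c by rewrite /Y opprB addrA subrK.
have t0 := pmf_inhabited.
have c_ge0 : 0 <= c by have := fc t0 t0; rewrite subrr.
have [t1 _ Y_min] := @arg_minP _ _ _ t0 predT Y isT; pose a := Y t1.
have aY t : a <= Y t by exact: Y_min.
have a_le0 : a <= 0 by rewrite -EY -(mean_cst a); exact: le_mean.
have ac_ge0 : 0 <= a + c.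
  rewrite -EY -(mean_cst (a + c)); apply: le_mean => t.
  by have := Yc t t1; rewrite -/a lerBlDl.
move: c_ge0; rewrite le_eqVlt => /orP[/eqP c0|c_gt0].
  have a0 : a = 0.
    by apply/eqP; rewrite eq_le a_le0/=; move: ac_ge0; rewrite -c0 addr0.
  have Y0 t : Y t = 0.
    apply/eqP; rewrite eq_le -{2}a0 aY andbT.
    by have := Yc t t1; rewrite -/a a0 subr0 c0.
  have -> : c ^+ 2 / 8 = 0 by rewrite -c0 expr0n mul0r.
  by rewrite expR0 -[leRHS]mean_cst; apply: le_mean => t; rewrite -/(Y t) Y0 expR0.
pose th := - a / c; pose s t := (Y t - a) / c.
have chord t : expR (Y t) <= (1 - s t) * expR a + s t * expR (a + c).
  have s_ge0 : 0 <= s t by rewrite divr_ge0 ?subr_ge0// ltW.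
  have s_le1 : 0 <= 1 - s t by rewrite subr_ge0 ler_pdivrMr// mul1r; exact: Yc.
  (* The chord bound is the convex combination of the tangent bounds at [Y t]. *)
  have tangent b : expR (Y t) * (1 + (b - Y t)) <= expR b.
    by rewrite -[in leRHS](subrK (Y t) b) (expRD (b - Y t)) mulrC
      ler_wpM2r ?expR_ge0// expR_ge1Dx.
  apply: le_trans (lerD (ler_wpM2l s_le1 (tangent a))
    (ler_wpM2l s_ge0 (tangent (a + c)))).
  rewrite le_eqVlt; apply/orP; left; apply/eqP; rewrite /s; field.
  by rewrite gt_eqF.
apply: (le_trans (le_mean chord)).
have th01 : 0 <= th <= 1.
  rewrite /th divr_ge0 ?oppr_ge0 ?(ltW c_gt0)//= ler_pdivrMr// mul1r.
  by rewrite lerNl -subr_ge0 opprK.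
apply: le_trans (two_point_mgf th01 (ltW c_gt0)).
have ->: - (th * c) = a by rewrite /th mulfVK ?gt_eqF// opprK.
have ->: (1 - th) * c = a + c by rewrite mulrBl /th mulfVK ?gt_eqF//; ring.
rewrite (_ : mean _ _ = mean p (fun t => expR a + s t * (expR (a + c) - expR a))).
  rewrite meanD mean_cst.
  rewrite (_ : mean p _ = mean p (fun t => (expR (a + c) - expR a) / c * (Y t - a))).
    rewrite meanZl meanB mean_cst EY /th le_eqVlt; apply/orP; left; apply/eqP; field.
    by rewrite gt_eqF.
  by apply: eq_mean => t; rewrite /s; ring.
by apply: eq_mean => t; ring.
Qed.

End mean_theory.

Section iid.
Context (T : finType) (p : T -> R).
Context (p_pmf : is_pmf p).

Definition iid n (w : n.-tuple T) : R := \prod_(i < n) p (tnth w i).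

Lemma mean_iid0 (f : 0.-tuple T -> R) : mean (@iid 0) f = f [tuple].
Proof.
rewrite /mean (big_pred1 [tuple]) => [|w]; last by apply/esym/eqP; exact: tuple0.
by rewrite /iid big_ord0 mul1r.
Qed.

Lemma mean_iidS n (f : n.+1.-tuple T -> R) :
  mean (@iid n.+1) f = mean p (fun a => mean (@iid n) (fun w => f [tuple of a :: w])).
Proof.
rewrite /mean.
under [RHS]eq_bigr do rewrite mulr_sumr.
rewrite pair_big/= (reindex (fun z : T * n.-tuple T => [tuple of z.1 :: z.2])).
  apply: eq_bigr => -[a w] _ /=; rewrite /iid big_ord_recl mulrA tnth0.
  by congr (_ * _ * _); apply: eq_bigr => i _; rewrite tnthS.
exists (fun w => (thead w, [tuple of behead w])) => [[a w] _|w _] /=.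
  by congr pair; rewrite ?theadE//; apply/val_inj.
by rewrite [RHS]tuple_eta.
Qed.

Lemma iid_pmf n : is_pmf (@iid n).
Proof.
split=> [w|]; first by apply: prodr_ge0 => i _; exact: p_pmf.1.
transitivity (mean (@iid n) (fun=> 1)).
  by apply: eq_bigr => w _; rewrite mulr1.
elim: n => [|n IH]; first by rewrite mean_iid0.
by rewrite mean_iidS IH mean_cst.
Qed.

Lemma mean_iid_tnth n (i : 'I_n) (g : T -> R) :
  mean (@iid n) (fun w => g (tnth w i)) = mean p g.
Proof.
elim: n i => [[]//|n IH] i; rewrite mean_iidS.
case: (unliftP ord0 i) => [j ->|->].
  transitivity (mean p (fun=> mean p g)); last by rewrite mean_cst.
  by apply: eq_mean => a; rewrite -(IH j); apply: eq_mean => w; rewrite tnthS.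
by apply: eq_mean => a; rewrite -[RHS](mean_cst (iid_pmf n)); apply: eq_mean.
Qed.

(** One-sided, since [v] and [w] can be exchanged. *)
Definition bounded_difference n (c : R) (f : n.-tuple T -> R) :=
  forall (i : 'I_n) v w,
    (forall j, j != i -> tnth v j = tnth w j) -> f v - f w <= c.

(** The martingale argument behind McDiarmid's inequality, as an induction on the
number of coordinates: conditionally on the first coordinate [a] the induction
hypothesis applies, and the conditional mean [g a] varies by at most [c], so
that Hoeffding's lemma controls it. *)
Lemma bounded_difference_mgf n c (f : n.-tuple T -> R) : bounded_difference c f ->
  mean (@iid n) (fun w => expR (f w - mean (@iid n) f)) <=
  expR (n%:R * (c ^+ 2 / 8)).
Proof.
elim: n f => [|n IH] f fc.
  by rewrite !mean_iid0 subrr mul0r.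
rewrite !mean_iidS.
pose g a := mean (@iid n) (fun w => f [tuple of a :: w]).
have gc a b : g a - g b <= c.
  rewrite -meanB -(mean_cst (iid_pmf n) c); apply: le_mean; first exact: iid_pmf.
  move=> w; apply: (fc ord0) => j; 
  case: (unliftP ord0 j) => [k ->|->]; last by rewrite eqxx.
  by rewrite !tnthS.
have fac a : bounded_difference c (fun w : n.-tuple T => f [tuple of a :: w]).
  move=> i v w vw; apply: (fc (lift ord0 i)) => j.
  case: (unliftP ord0 j) => [k ->|->]; last by rewrite !tnth0.
  by rewrite (inj_eq (@lift_inj _ _)) !tnthS; exact: vw.
apply: (@le_trans _ _
  (mean p (fun a => expR (n%:R * (c ^+ 2 / 8)) * expR (g a - mean p g)))).
  apply: le_mean => // a; rewrite -/g.
  have -> : mean (@iid n) (fun w => expR (f [tuple of a :: w] - mean p g)) =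
      expR (g a - mean p g) *
      mean (@iid n) (fun w => expR (f [tuple of a :: w] - g a)).
    by rewrite -meanZl; apply: eq_mean => w; rewrite -expRD; congr expR; ring.
  by rewrite mulrC ler_wpM2r ?expR_ge0//; exact: IH.
rewrite meanZl -(natr1 n) mulrDl mul1r expRD ler_wpM2l ?expR_ge0//.
exact: hoeffding.
Qed.

End iid.
End finite_mean.

(** * McDiarmid's inequality and log-sum-exp *)

Section concentration.
Context (R : realType).

Lemma mean_gt0 (T : finType) (p f : T -> R) :
  is_pmf p -> (forall t, 0 < f t) -> 0 < mean p f.
Proof.
move=> p_pmf f_gt0; rewrite lt_neqAle mean_ge0// => [|t]; last exact: ltW.
rewrite andbT eq_sym; apply/eqP => /eqP; rewrite psumr_eq0 => [/allP pf0|t _].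
  have [_ /eqP] := p_pmf; rewrite big1 ?(eq_sym 0) ?oner_eq0// => t _.
  have := pf0 t; rewrite mem_index_enum => /(_ isT).
  by rewrite /= mulf_eq0 (gt_eqF (f_gt0 t)) orbF => /eqP.
by rewrite mulr_ge0 ?(ltW (f_gt0 t))//; exact: p_pmf.1.
Qed.

Section mcdiarmid.
Context (T : finType) (p : T -> R).
Context (p_pmf : is_pmf p).

Lemma bounded_difference_scale n c (f : n.-tuple T -> R) a : 0 <= a ->
  bounded_difference c f -> bounded_difference (a * c) (fun w => a * f w).
Proof. by move=> a0 fc i v w vw; rewrite -mulrBr ler_wpM2l//; exact: (fc i). Qed.

Lemma bounded_differenceN n c (f : n.-tuple T -> R) :
  bounded_difference c f -> bounded_difference c (fun w => - f w).
Proof.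
move=> fc i v w vw; rewrite opprK addrC; apply: (fc i) => j ji.
by rewrite vw.
Qed.

(** Chernoff's method: bound the indicator by an exponential and use
[bounded_difference_mgf] with the optimal exponential rate [t]. *)
Lemma mcdiarmid n (f : n.-tuple T -> R) (c r : R) :
  (0 < n)%N -> 0 < c -> 0 <= r -> bounded_difference c f ->
  mean (iid p (n:=n)) (fun w => (r < f w - mean (iid p (n:=n)) f)%R%:R) <=
  expR (- (2 * r ^+ 2 / (n%:R * c ^+ 2))).
Proof.
move=> n_gt0 c_gt0 r_ge0 fc; set P := iid p (n:=n).
have P_pmf : is_pmf P by exact: iid_pmf.
have n_pos : 0 < n%:R :> R by rewrite ltr0n.
have c_neq0 : c != 0 by rewrite gt_eqF.
have n_neq0 : n%:R != 0 :> R by rewrite gt_eqF.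
pose t := 4 * r / (n%:R * c ^+ 2).
have t_ge0 : 0 <= t by rewrite divr_ge0 ?mulr_ge0 ?sqr_ge0// ltW.
apply: (@le_trans _ _ (mean P (fun w =>
    expR (- (t * r)) * expR (t * f w - mean P (fun w => t * f w))))).
  apply: le_mean => // w; rewrite meanZl -expRD -mulrBr.
  case: (ltP r) => [r_lt|_]; last exact: expR_ge0.
  by rewrite -expR0 ler_expR addrC subr_ge0 ler_wpM2l// ltW.
rewrite meanZl.
apply: (le_trans (ler_wpM2l (expR_ge0 _)
  (bounded_difference_mgf p_pmf (bounded_difference_scale t_ge0 fc)))).
rewrite -expRD ler_expR le_eqVlt; apply/orP; left; apply/eqP; rewrite /t.
by field; rewrite n_neq0 c_neq0.
Qed.

Lemma mcdiarmid_abs n (f : n.-tuple T -> R) (c r : R) :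
  (0 < n)%N -> 0 < c -> 0 <= r -> bounded_difference c f ->
  mean (iid p (n:=n)) (fun w => (r < `|f w - mean (iid p (n:=n)) f|)%R%:R) <=
  2 * expR (- (2 * r ^+ 2 / (n%:R * c ^+ 2))).
Proof.
move=> n_gt0 c_gt0 r_ge0 fc; rewrite mulr_natl mulr2n.
apply: le_trans (lerD (mcdiarmid n_gt0 c_gt0 r_ge0 fc)
  (mcdiarmid n_gt0 c_gt0 r_ge0 (bounded_differenceN fc))).
rewrite -meanD; apply: le_mean => [|w]; first exact: iid_pmf.
rewrite meanN -(opprD (f w)) ltr_normr -natrD ler_nat.
by case: (r < _); case: (r < _).
Qed.

End mcdiarmid.

Section log_sum_exp.
Context (K : finType) (A : pred K).
Context (A_neq0 : exists k, A k).
Implicit Types v mu : K -> R.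

Definition lse v : R := ln (\sum_(k | A k) expR (v k)).

Lemma sum_expR_gt0 v : 0 < \sum_(k | A k) expR (v k).
Proof.
have [k Ak] := A_neq0; rewrite (bigD1 k)//= ltr_pwDl ?expR_gt0//.
by apply: sumr_ge0 => i _; exact: expR_ge0.
Qed.

Lemma lse_le_add v mu c : (forall k, A k -> v k <= mu k + c) -> lse v <= lse mu + c.
Proof.
move=> vmu; rewrite /lse -[X in _ + X]expRK -lnM ?posrE ?expR_gt0 ?sum_expR_gt0//.
rewrite ler_ln ?posrE ?mulr_gt0 ?expR_gt0 ?sum_expR_gt0// mulr_suml.
by apply: ler_sum => k Ak; rewrite -expRD ler_expR vmu.
Qed.

(** Log-sum-exp is convex: it lies above its tangent plane at [mu], whose slopes
are the Gibbs weights of [mu].  With [d] the increment along that plane, apply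
[1 + x <= expR x] to [v k - mu k - d], whose weighted mean is 0. *)
Lemma lse_gradient v mu :
  lse mu + \sum_(k | A k) expR (mu k) / (\sum_(l | A l) expR (mu l)) * (v k - mu k) <=
  lse v.
Proof.
set Z := \sum_(l | A l) expR (mu l).
have Z_gt0 : 0 < Z by exact: sum_expR_gt0.
set d := \sum_(k | A k) _.
have Zd : Z * d = \sum_(k | A k) expR (mu k) * (v k - mu k).
  rewrite mulr_sumr; apply: eq_bigr => k _; field; exact: lt0r_neq0.
rewrite /lse -[X in _ + X]expRK -lnM ?posrE ?expR_gt0//.
rewrite ler_ln ?posrE ?mulr_gt0 ?expR_gt0 ?sum_expR_gt0//.
have -> : Z * expR d = \sum_(k | A k) expR (mu k) * (expR d * (1 + (v k - mu k - d))).
  transitivity (expR d * (Z * (1 - d) + Z * d)); first by ring.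
  rewrite Zd {1}/Z mulr_suml -big_split mulr_sumr /=.
  by apply: eq_bigr => k _; ring.
apply: ler_sum => k _; rewrite -[in leRHS](subrK (mu k) (v k)).
rewrite (expRD (v k - mu k)) mulrC.
rewrite ler_wpM2r ?expR_ge0//.
rewrite -[in leRHS](subrK d (v k - mu k)) (expRD (v k - mu k - d)) mulrC.
by rewrite ler_wpM2r ?expR_ge0 ?expR_ge1Dx.
Qed.

Context (T : finType) (p : T -> R).
Context (p_pmf : is_pmf p).

Lemma lse_mean_le (V : T -> K -> R) :
  lse (fun k => mean p (V ^~ k)) <= mean p (fun t => lse (V t)).
Proof.
set mu := fun k => _.
apply: le_trans (le_mean p_pmf (fun t => lse_gradient (V t) mu)).
rewrite meanD mean_cst// mean_sum lerDl sumr_ge0// => k _.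
by rewrite meanZl meanB mean_cst// subrr mulr0.
Qed.

(** Jensen's inequality for the logarithm, by averaging its tangent at the point
[mean p S]. *)
Lemma mean_ln_le (S : T -> R) : (forall t, 0 < S t) ->
  mean p (fun t => ln (S t)) <= ln (mean p S).
Proof.
move=> S_gt0.
have a_gt0 : 0 < mean p S by exact: mean_gt0.
apply: (@le_trans _ _ (mean p (fun t => ln (mean p S) + ((mean p S)^-1 * S t - 1)))).
  apply: le_mean => // t; rewrite -lerBlDl -ln_div ?posrE//.
  rewrite [(mean p S)^-1 * _]mulrC.
  have -> : S t / mean p S = 1 + (S t / mean p S - 1) by rewrite addrC subrK.
  rewrite [1 + _ - 1]addrC addKr; apply: le_ln1Dx.
  by have := divr_gt0 (S_gt0 t) a_gt0; lra.
by rewrite meanD meanB meanZl !mean_cst// mulVf ?subrr ?addr0// gt_eqF.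
Qed.

(** The reverse of [lse_mean_le] up to [b]: after [mean_ln_le], the average of
the sum of exponentials is computed term by term. *)
Lemma mean_lse_le (V : T -> K -> R) mu b :
  (forall k, A k -> mean p (fun t => expR (V t k - mu k)) <= expR b) ->
  mean p (fun t => lse (V t)) <= lse mu + b.
Proof.
move=> Vb; apply: (le_trans (mean_ln_le (fun t => sum_expR_gt0 (V t)))).
rewrite /lse -[X in _ + X]expRK -lnM ?posrE ?expR_gt0 ?sum_expR_gt0//.
rewrite mean_sum mulr_suml.
have le_sum : \sum_(k | A k) mean p (fun t => expR (V t k)) <=
    \sum_(k | A k) expR (mu k) * expR b.
  apply: ler_sum => k Ak; apply: le_trans (ler_wpM2l (expR_ge0 _) (Vb _ Ak)).
  rewrite -meanZl; apply: le_mean => // t.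
  by rewrite -expRD addrC subrK.
rewrite ler_ln// posrE.
  by rewrite -mean_sum mean_gt0// => t; exact: sum_expR_gt0.
rewrite -mulr_suml; exact: mulr_gt0 (sum_expR_gt0 _) (expR_gt0 _).
Qed.

End log_sum_exp.
End concentration.

(** * Concentration of the empirical log ratio *)

Section empirical_log_ratio.
Context (R : realType) (T : finType) (p : T -> R).
Context (p_pmf : is_pmf p).
Context (K : finType) (loss : T -> K -> R) (eta : R) (n : nat).
Context (eta_gt0 : 0 < eta).
Context (n_gt0 : (0 < n)%N).
Context (loss_ge0 : forall t k, 0 <= loss t k).
Context (loss_le1 : forall t k, loss t k <= 1).

Definition risk k : R := mean p (loss ^~ k).

Definition empirical_risk (w : n.-tuple T) k : R :=
  n%:R^-1 * \sum_(i < n) loss (tnth w i) k.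

Let P := iid p (n:=n).
Let V w k := - eta * empirical_risk w k.
Let mu k := - eta * risk k.
Let P_pmf : is_pmf P. Proof. exact: iid_pmf. Qed.
Let n_pos : 0 < n%:R :> R. Proof. by rewrite ltr0n. Qed.
Let n_neq0 : n%:R != 0 :> R. Proof. by rewrite gt_eqF. Qed.

Lemma mean_empirical_risk k : mean P (empirical_risk ^~ k) = risk k.
Proof.
rewrite /empirical_risk meanZl mean_sum.
rewrite (eq_bigr (fun=> risk k)) => [|i _]; last first.
  exact: (mean_iid_tnth p_pmf i (loss ^~ k)).
by rewrite sumr_const card_ord -[X in _ * X]mulr_natl mulrA mulVf// mul1r.
Qed.

Lemma empirical_risk_difference (i : 'I_n) v w k :
  (forall j, j != i -> tnth v j = tnth w j) ->
  empirical_risk v k - empirical_risk w k <= n%:R^-1.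
Proof.
move=> vw; rewrite -mulrBr -[leRHS]mulr1 ler_wpM2l ?invr_ge0 ?(ltW n_pos)//.
rewrite -sumrB (bigD1 i)//= big1 => [|j ji]; last by rewrite vw ?subrr.
by rewrite addr0 lerBlDr -[leLHS]addr0 lerD.
Qed.

Lemma scaled_risk_difference (i : 'I_n) v w k :
  (forall j, j != i -> tnth v j = tnth w j) -> V v k <= V w k + eta / n%:R.
Proof.
move=> vw; rewrite /V !mulNr -lerBlDl opprK addrC -mulrBr ler_wpM2l ?(ltW eta_gt0)//.
by apply: (empirical_risk_difference (i := i)) => j ji; rewrite vw.
Qed.

Lemma mean_scaled_risk k : mean P (V ^~ k) = mu k.
Proof. by rewrite /V meanZl mean_empirical_risk. Qed.

Lemma scaled_risk_mgf k :
  mean P (fun w => expR (V w k - mu k)) <= expR (eta ^+ 2 / (8 * n%:R)).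
Proof.
have -> : eta ^+ 2 / (8 * n%:R) = n%:R * ((eta / n%:R) ^+ 2 / 8) by field.
rewrite -(mean_scaled_risk k); apply: bounded_difference_mgf => // i v w vw.
by rewrite lerBlDl; exact: scaled_risk_difference vw.
Qed.

Section one_side.
Context (A : pred K) (A_neq0 : exists k, A k).

Lemma mean_lse_ge : lse A mu <= mean P (fun w => lse A (V w)).
Proof.
apply: le_trans (lse_mean_le A_neq0 P_pmf V).
by rewrite /lse; under [in leRHS]eq_bigr do rewrite mean_scaled_risk.
Qed.

Lemma mean_lse_le_bias :
  mean P (fun w => lse A (V w)) <= lse A mu + eta ^+ 2 / (8 * n%:R).
Proof. by apply: mean_lse_le => // k _; exact: scaled_risk_mgf. Qed.

Lemma lse_difference : bounded_difference (eta / n%:R) (fun w => lse A (V w)).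
Proof.
move=> i v w vw; rewrite lerBlDl; apply: lse_le_add => // k _.
exact: scaled_risk_difference vw.
Qed.

End one_side.

Section two_sides.
Context (A B : pred K) (A_neq0 : exists k, A k) (B_neq0 : exists k, B k).

Let L v := eta^-1 * (lse A v - lse B v).

Lemma log_ratio_difference : bounded_difference (2 / n%:R) (fun w => L (V w)).
Proof.
move=> i v w vw.
have wv j : j != i -> tnth w j = tnth v j by move=> ji; rewrite vw.
have := lse_difference A_neq0 vw; have := lse_difference B_neq0 wv.
rewrite /L -mulrBr ler_pdivrMl// => hB hA.
have -> : eta * (2 / n%:R) = eta / n%:R + eta / n%:R by ring.
by apply: le_trans (lerD hA hB); rewrite le_eqVlt; apply/orP; left; apply/eqP; ring.
Qed.

(** The biases of the two log-sum-exps both lie between 0 and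
[eta ^+ 2 / (8 * n%:R)], so subtracting them does not double the error. *)
Lemma log_ratio_bias : `|mean P (fun w => L (V w)) - L mu| <= eta / (8 * n%:R).
Proof.
rewrite meanZl meanB -mulrBr normrM gtr0_norm ?invr_gt0// ler_pdivrMl//.
have -> : eta * (eta / (8 * n%:R)) = eta ^+ 2 / (8 * n%:R) by ring.
have := mean_lse_ge A_neq0; have := mean_lse_ge B_neq0.
have := mean_lse_le_bias A_neq0; have := mean_lse_le_bias B_neq0.
by rewrite ler_norml; lra.
Qed.

Lemma log_ratio_concentration (lam : R) : 0 <= lam ->
  mean P (fun w => (2 * lam + eta / (8 * n%:R) < `|L (V w) - L mu|)%R%:R) <=
  2 * expR (- (2 * n%:R * lam ^+ 2)).
Proof.
move=> lam_ge0.
have -> : 2 * n%:R * lam ^+ 2 = 2 * (2 * lam) ^+ 2 / (n%:R * (2 / n%:R) ^+ 2).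
  by field.
apply: le_trans (mcdiarmid_abs p_pmf _ _ _ log_ratio_difference) => //; last 2 first.
- by rewrite divr_gt0.
- by rewrite mulr_ge0.
apply: le_mean => // w; rewrite ler_nat -/P.
case: ltP => //= lt1; rewrite lt0b; move: lt1; apply: contraTT.
rewrite -!leNgt => le2; apply: le_trans (lerD le2 log_ratio_bias).
by rewrite (le_trans _ (ler_normD _ _))// addrA subrK.
Qed.

End two_sides.
End empirical_log_ratio.

Section markov_fubini.
Context (R : realType) (T W : finType) (p : T -> R) (P : W -> R).
Context (p_pmf : is_pmf p) (P_pmf : is_pmf P).

Lemma mean_exchange (F : W -> T -> R) :
  mean P (fun w => mean p (F w)) = mean p (fun t => mean P (F ^~ t)).
Proof.
rewrite /mean; under eq_bigr do rewrite mulr_sumr.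
rewrite exchange_big/=; apply: eq_bigr => t _; rewrite mulr_sumr.
by apply: eq_bigr => w _; rewrite mulrCA.
Qed.

Lemma markov_mean (f : W -> R) (a b : R) : 0 < a -> (forall w, 0 <= f w) ->
  mean P f <= a * b -> mean P (fun w => (a < f w)%R%:R) <= b.
Proof.
move=> a_gt0 f_ge0 fab; rewrite -(ler_pM2l a_gt0); apply: le_trans fab.
rewrite -meanZl; apply: le_mean => // w.
by case: ltP => [/ltW|_]; rewrite ?mulr1 ?mulr0.
Qed.

(** If each point [t] is bad for few [w], then for most [w] few points are bad:
Markov's inequality for the mass of the bad points of [w], whose average is
computed with the two variables exchanged. *)
Lemma mostly_small_sections (bad : W -> T -> bool) (delta : R) : 0 < delta ->
  (forall t, mean P (fun w => (bad w t)%:R) <= delta ^+ 2) ->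
  mean P (fun w => (delta < mean p (fun t => (bad w t)%:R))%R%:R) <= delta.
Proof.
move=> delta_gt0 badP; apply: markov_mean => // [w|]; first exact: mean_ge0.
by rewrite mean_exchange -expr2 -(mean_cst p_pmf (delta ^+ 2)); exact: le_mean.
Qed.

End markov_fubini.

(** * Reduction to a finite probability space *)

Section finite_image.
Context (R : realType) (d : measure_display) (S : measurableType d) (T : finType).

Lemma measure_finite_image (mu : {measure set S -> \bar R}) (f : S -> T)
    (A : pred T) : (forall t, measurable (f @^-1` [set t])) ->
  mu [set s | A (f s)] = (\sum_(t | A t) mu (f @^-1` [set t]))%E.
Proof.
move=> mf.
have -> : [set s | A (f s)] = \bigcup_(t in [set` enum A]) f @^-1` [set t].
  apply/seteqP; split=> [s As|s [t /=]].
    by exists (f s) => //=; rewrite mem_enum.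
  by rewrite mem_enum => At ->.
rewrite measure_fin_bigcup//.
  by rewrite -fsbig_seq ?enum_uniq// big_enum.
by move=> t t' _ _ [s [/= <- <-]].
Qed.

End finite_image.

Section finite_law.
Context (R : realType) (d : measure_display) (S : measurableType d) (T : finType).
Context (D : probability S R) (f : S -> T).
Context (mf : forall t, measurable (f @^-1` [set t])).

Definition law t : R := fine (D (f @^-1` [set t])).

Lemma law_fin t : D (f @^-1` [set t]) = (law t)%:E.
Proof. by rewrite /law fineK// fin_num_measure. Qed.

Lemma law_probability (A : pred T) :
  D [set s | A (f s)] = (mean law (fun t => (A t)%:R))%:E.
Proof.
rewrite measure_finite_image// (eq_bigr _ (fun t _ => law_fin t)) sumEFin.
rewrite /mean big_mkcond/=; congr EFin; apply: eq_bigr => t _.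
by case: (A t); rewrite ?mulr1 ?mulr0.
Qed.

Lemma law_pmf : is_pmf law.
Proof.
split=> [t|]; first exact: fine_ge0.
apply: EFin_inj; rewrite -sumEFin -(eq_bigr _ (fun t _ => law_fin t)).
rewrite -(measure_finite_image D predT mf).
by rewrite -[RHS](@probability_setT _ _ _ D); congr (D _); apply/seteqP.
Qed.

(** The images under [f] of independent draws from [D] are independent draws from
[law], because the fibres of [map_tuple f] are measurable boxes. *)
Lemma law_sample_probability n (A : pred (n.-tuple T)) :
  prod_probability D n [set s | A (map_tuple f s)] =
  (mean (iid law (n:=n)) (fun w => (A w)%:R))%:E.
Proof.
have fibre (w : n.-tuple T) :
    @map_tuple n _ _ f @^-1` [set w] = [set s | forall i, f (tnth s i) = tnth w i].
  apply/seteqP; split=> s /= => [<- i|fs]; first by rewrite tnth_map.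
  by apply: eq_from_tnth => i; rewrite tnth_map.
rewrite (@measure_finite_image _ _ _ _ _ (@map_tuple n _ _ f)).
  rewrite /mean big_mkcond/= -sumEFin; apply: eq_bigr => w _.
  case: (A w); last by rewrite mulr0.
  rewrite mulr1 fibre (@prod_probabilityE _ _ _ D n (fun i => f @^-1` [set tnth w i]))//.
  by rewrite /iid -prodEFin; apply: eq_bigr => i _; rewrite law_fin.
move=> w; rewrite fibre.
rewrite (_ : [set s | _] =
    \bigcap_(i in [set: 'I_n]) ((@tnth n S)^~ i @^-1` (f @^-1` [set tnth w i]))).
  apply: fin_bigcap_measurable => [|i _]; first exact: finite_finset.
  by rewrite -[X in measurable X]setTI; exact: measurable_tnth.
by apply/seteqP; split => s/= h i; [move=> _|]; exact: h.
Qed.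

End finite_law.

Section patterns.
Context (R : realType) (d : measure_display) (X : measurableType d).
Context (H : {fset (X -> bool)}).

Definition pattern (x : X) : {ffun H -> bool} := [ffun h => val h x].

Definition labelled_pattern (z : X * bool) := (pattern z.1, z.2).

Definition mistake (t : {ffun H -> bool} * bool) (h : H) : R := (t.1 h != t.2)%:R.

Lemma measurable_labelled_pattern_fibre t :
  (forall h : X -> bool, h \in H -> measurable_fun [set: X] h) ->
  measurable (labelled_pattern @^-1` [set t]).
Proof.
move=> mH; case: t => g b.
rewrite (_ : _ @^-1` _ = [set z | z.2 = b] `&`
    \bigcap_(h in [set: H]) [set z | val h z.1 = g h]).
  apply: measurableI.
    rewrite -[X in measurable X]setTI.
    have msnd : measurable_fun [set: X * bool] snd by exact: measurable_snd.
    exact: (msnd measurableT [set b]).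
  apply: fin_bigcap_measurable => [|h _]; first exact: finite_finset.
  rewrite -[X in measurable X]setTI.
  have mh : measurable_fun [set: X * bool] (fun z : X * bool => val h z.1).
    by apply: measurableT_comp (mH _ (valP h)) measurable_fst.
  exact: (mh measurableT [set g h]).
apply/seteqP; split=> [[x y]/= [<- <-]|[x y]/= [-> xg]].
  by split=> // h _ /=; rewrite ffunE.
by congr pair; apply/ffunP => h; rewrite ffunE; exact: xg.
Qed.

(** Here [v] stands for [- eta] times the error. *)
Definition pattern_log_ratio (eta : R) (v : H -> R) (g : {ffun H -> bool}) : \bar R :=
  if [forall h, g h] then +oo%E
  else if [forall h, ~~ g h] then -oo%E
  else (eta^-1 * (lse (fun h => g h) v - lse (fun h => ~~ g h) v))%:E.

Lemma all_fsetE (P : pred (X -> bool)) : all P H = [forall h : H, P (val h)].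
Proof.
apply/allP/forallP => [PH h|PH h hH]; first exact/PH/valP.
exact: (PH [` hH]%fset).
Qed.

(** The step that makes the problem finite: a log ratio sees [x] only through its
pattern. *)
Lemma log_ratio_pattern eta (err : (X -> bool) -> R) x :
  log_ratio H eta err x =
  pattern_log_ratio eta (fun h => - eta * err (val h)) (pattern x).
Proof.
rewrite /log_ratio /pattern_log_ratio !all_fsetE.
have xE h : pattern x h = val h x by rewrite ffunE.
rewrite (eq_forallb xE) (eq_forallb (fun h => congr1 negb (xE h))).
case: ifPn => // /forallPn[h0 h0x]; case: ifPn => // /forallPn[h1 h1x].
congr (_ * _)%:E; rewrite !big_seq_fsetE/= /lse ln_div ?posrE.
- by congr (ln _ - ln _); apply: eq_bigl => h; rewrite xE.
- by apply: sum_expR_gt0; exists h1; move: h1x; rewrite negbK.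
- by apply: sum_expR_gt0; exists h0.
Qed.

End patterns.

(** * Wrong predictions *)

(** When all hypotheses agree, both log ratios are the same infinite value, so
the signs can differ only when each label is predicted by some hypothesis.  The
finite value [L v] exceeds [Delta >= 0] in absolute value, so its sign is
nonzero, and [L mu] lies weakly on the other side of 0: the distance from [L v]
to [L mu] is at least that from [L v] to 0. *)
Lemma sign_disagreement (R : realType) (d : measure_display)
    (X : measurableType d) (H : {fset (X -> bool)}) (s0 : int)
    (eta Delta : R) (v mu : H -> R) (g : {ffun H -> bool}) :
  let L u := eta^-1 * (lse (fun h => g h) u - lse (fun h => ~~ g h) u) in
  0 <= Delta -> (Delta%:E < `|pattern_log_ratio eta v g|)%E ->
  esign s0 (pattern_log_ratio eta v g) <> esign s0 (pattern_log_ratio eta mu g) ->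
  [/\ exists h, g h, exists h, ~~ g h & Delta < `|L v - L mu|].
Proof.
move=> L Delta_ge0; rewrite /pattern_log_ratio.
case: ifPn => [_ _ //|/forallPn[h0 gh0]]; case: ifPn => [_ _ //|/forallPn[h1 gh1]].
rewrite -/(L v) -/(L mu) abse_EFin lte_fin => lt_L; rewrite /esign !lte_fin => neq.
split; [by exists h1; move: gh1; rewrite negbK|by exists h0|].
move: lt_L neq; rewrite !ltr_normr => /orP[] lt_L.
  have -> : 0 < L v by exact: le_lt_trans lt_L.
  case: ltP => // L_le0 _; apply/orP; left.
  by rewrite (lt_le_trans lt_L)// lerDl oppr_ge0.
have Lv_lt0 : L v < 0 by rewrite -oppr_gt0; exact: le_lt_trans lt_L.
rewrite ltNge (ltW Lv_lt0)/= Lv_lt0.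
have [L_gt0 _|_] := ltP 0 (L mu); last case: ltP => // L_ge0 _.
  by apply/orP; right; rewrite (lt_le_trans lt_L)// opprB lerDr ltW.
by apply/orP; right; rewrite (lt_le_trans lt_L)// opprB lerDr.
Qed.

Theorem theorem2 (R : realType) (d : measure_display) (X : measurableType d)
    (H : {fset (X -> bool)}) (D : probability (X * bool)%type R) (m : nat)
    (eta delta : R) (s0 : int)
    (H_neq0 : H != fset0)
    (H_meas : forall h : X -> bool, h \in H -> measurable_fun [set: X] h)
    (m_ge1 : (1 <= m)%N)
    (eta_gt0 : 0 < eta)
    (delta_gt0 : 0 < delta)
    (delta_le : delta <= Num.sqrt 2)
    (s0_sign : s0 \in [:: -1; 0; 1]) :
  let Delta := 2 * Num.sqrt (ln (Num.sqrt 2 / delta) / m%:R)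
               + eta / (8 * m%:R) in
  ((1 - delta)%:E <=
   prod_probability D m
     [set S : m.-tuple (X * bool) |
       D [set z : X * bool |
           prediction s0 H eta Delta S z.1 <> 0%R /\
           prediction s0 H eta Delta S z.1 <>
             esign s0 (log_ratio H eta (true_error D) z.1)]
       <= delta%:E])%E.
Proof.
cbv zeta; set lam := Num.sqrt (ln _ / _); set Delta := 2 * lam + _.
have m_pos : 0 < m%:R :> R by rewrite ltr0n.
have lam_ge0 : 0 <= lam by exact: sqrtr_ge0.
have Delta_ge0 : 0 <= Delta.
  by rewrite addr_ge0 ?mulr_ge0 ?invr_ge0// ?mulr_ge0// ltW.
(* The value of [lam] is the one for which McDiarmid's bound is [delta ^+ 2]. *)
have tail : 2 * expR (- (2 * m%:R * lam ^+ 2)) = delta ^+ 2.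
  have ratio_ge1 : 1 <= Num.sqrt 2 / delta by rewrite ler_pdivlMr// mul1r.
  have ratio_gt0 := lt_le_trans ltr01 ratio_ge1.
  rewrite /lam sqr_sqrtr ?divr_ge0 ?ln_ge0// ?(ltW m_pos)//.
  have -> : 2 * m%:R * (ln (Num.sqrt 2 / delta) / m%:R) = ln ((Num.sqrt 2 / delta) ^+ 2).
    by rewrite lnXn// -mulr_natl; field; rewrite gt_eqF.
  rewrite expRN lnK ?posrE ?exprn_gt0// expr_div_n sqr_sqrtr//.
  by field; rewrite gt_eqF.
have mf t : measurable (labelled_pattern H @^-1` [set t]).
  exact: measurable_labelled_pattern_fibre.
set phi := labelled_pattern H in mf.
set p := law D phi; have p_pmf : is_pmf p by exact: law_pmf.
pose loss := @mistake R d X H.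
pose lhat (w : m.-tuple _) g :=
  pattern_log_ratio eta (fun h => - eta * empirical_risk loss w h) g.
pose l g := pattern_log_ratio eta (fun h => - eta * risk p loss h) g.
pose wrong (w : m.-tuple _) (t : {ffun H -> bool} * bool) :=
  [&& (Delta%:E < `|lhat w t.1|)%E, esign s0 (lhat w t.1) != 0 &
      esign s0 (lhat w t.1) != esign s0 (l t.1)].
have lE z : log_ratio H eta (true_error D) z.1 = l (phi z).1.
  rewrite log_ratio_pattern; congr pattern_log_ratio; apply/funext => h.
  congr (_ * _); rewrite /true_error.
  pose errs (t : {ffun H -> bool} * bool) := t.1 h != t.2.
  rewrite (_ : [set _ | _] = [set z | errs (phi z)]).
    by rewrite (law_probability D mf errs).
  by apply/seteqP; split=> -[x y]; rewrite /errs /= ffunE.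
have lhatE (S : m.-tuple (X * bool)) z :
    log_ratio H eta (empirical_error R S) z.1 = lhat (map_tuple phi S) (phi z).1.
  rewrite log_ratio_pattern; congr pattern_log_ratio; apply/funext => h.
  congr (_ * _); rewrite /empirical_error /empirical_risk; congr (_ * _).
  by apply: eq_bigr => i _; rewrite tnth_map /loss /mistake /= ffunE.
have wrongE (S : m.-tuple (X * bool)) :
    [set z : X * bool | prediction s0 H eta Delta S z.1 <> 0%R /\
       prediction s0 H eta Delta S z.1 <> esign s0 (log_ratio H eta (true_error D) z.1)]
    = [set z | wrong (map_tuple phi S) (phi z)].
  apply/seteqP; split=> z /=; rewrite /prediction lE lhatE /wrong.
    by case: ifP => [_ [/eqP -> /eqP ->]|_ []].
  by move=> /and3P[-> /eqP ? /eqP ?].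
(* At a pattern on which all hypotheses agree no prediction is wrong; elsewhere
a wrong prediction is a large deviation of the log ratio. *)
have wrong_rare t : mean (iid p (n := m)) (fun w => (wrong w t)%:R) <= delta ^+ 2.
  pose A : pred H := fun h => t.1 h; pose B : pred H := fun h => ~~ t.1 h.
  have [[A0 B0]|AB] := pselect ((exists h, A h) /\ (exists h, B h)).
    have loss_ge0 u h : 0 <= loss u h by rewrite /loss /mistake ler0n.
    have loss_le1 u h : loss u h <= 1 by rewrite /loss /mistake lern1 leq_b1.
    have := log_ratio_concentration p_pmf eta_gt0 m_ge1 loss_ge0 loss_le1 A0 B0 lam_ge0.
    rewrite tail; apply: le_trans; apply: le_mean => [|w]; first exact: iid_pmf.
    rewrite ler_nat; case wr : (wrong w t) => //.
    move: wr => /and3P[big _ /eqP neq].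
    by have [_ _ ->] := sign_disagreement Delta_ge0 big neq.
  rewrite (_ : mean _ _ = 0) ?sqr_ge0//.
  rewrite -(mean_cst (iid_pmf p_pmf m) 0); apply: eq_mean => w.
  case wr : (wrong w t) => //; exfalso; apply: AB.
  move: wr => /and3P[big _ /eqP neq].
  by have [] := sign_disagreement Delta_ge0 big neq.
pose good (w : m.-tuple _) := ~~ (delta < mean p (fun t => (wrong w t)%:R)).
rewrite (_ : [set S | _] = [set S | good (map_tuple phi S)]).
  rewrite (law_sample_probability D mf good) lee_fin /good.
  rewrite (_ : mean _ _ = 1 - mean (iid p (n := m))
      (fun w => (delta < mean p (fun t => (wrong w t)%:R))%R%:R)).
    rewrite lerD2l lerN2; apply: mostly_small_sections => //; exact: iid_pmf.
  rewrite -[X in _ = X - _](mean_cst (iid_pmf p_pmf m)) -meanB; apply: eq_mean => w.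
  by case: (_ < _)%R; rewrite ?subrr ?subr0.
apply/seteqP; split=> S /=; rewrite wrongE
  (law_probability D mf (wrong (map_tuple phi S))) lee_fin.
  by rewrite leNgt.
by rewrite leNgt.
Qed.
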